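(* Let $\Sigma$ be a non-lacunary semigroup of $\mathbb{N}$, let $d\in\mathbb{N}$, and let $\ell_1,\ldots,\ell_d\in\mathbb{N}$ (not necessarily distinct). Let $A$ be a non-empty closed subset of $\mathbb{T}^d$ that is invariant under $$\{(s^{\ell_1},\ldots,s^{\ell_d})\colon s\in\Sigma\}.$$ Then $A$ contains a rational point with denominators relatively prime to $\Sigma$.
   Context: $\mathbb{N}$ denotes the set of positive integers and $\mathbb{T}=\mathbb{R}/\mathbb{Z}$. A semigroup of $\mathbb{N}$ is a sub-semigroup of $(\mathbb{N},\cdot)$. Two integers $p,q\ge 2$ are multiplicatively independent if their only common power is $1$, i.e. there are no $a,b\in\mathbb{N}$ with $p^a=q^b$. A semigroup of $\mathbb{N}$ is non-lacunary if it contains two multiplicatively independent integers (equivalently, it is not contained in the set of powers of a single integer). For $(k_1,\ldots,k_d)\in\mathbb{Z}^d$ and $(x_1,\ldots,x_d)\in\mathbb{T}^d$, write $(k_1,\ldots,k_d)\cdot(x_1,\ldots,x_d):=(k_1x_1,\ldots,k_dx_d)$. If $S\subset\mathbb{Z}^d$ and $A\subset\mathbb{T}^d$, then $A$ is invariant under $S$ if $s\cdot x\in A$ for every $s\in S$ and $x\in A$. A point $x\in\mathbb{T}^d$ is rational if all its coordinates are rational (mod $1$). The denominators of a rational point $x$ are relatively prime to $\Sigma$ if each coordinate of $x$ is a rational whose denominator (in lowest terms) is relatively prime to each element of $\Sigma$; by convention the denominator of $0$ is $1$. *)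

(* Defs.v *)
From HB Require Import structures.
From mathcomp Require Import all_boot all_order all_algebra.
From mathcomp Require Import generic_quotient ring_quotient.
From mathcomp Require Import all_classical all_reals all_analysis.

Set Implicit Arguments.
Unset Strict Implicit.
Unset Printing Implicit Defensive.

Import Order.TTheory GRing.Theory Num.Theory.
Import numFieldNormedType.Exports.

Local Open Scope classical_set_scope.
Local Open Scope ring_scope.
Local Open Scope quotient_scope.

(* [Num.int] is the qualifier wrapping [Num.int_num_subdef], and the library
   attaches the subgroup structure to the latter. *)
Definition int_subgroup (R : realType) : zmodClosed R :=
  GRing.ZmodClosed.clone R (@Num.int_num_subdef R) _.

(* The torus carries both the quotient group structure and the quotient
   topology of R. *)
Definition torus (R : realType) : Type :=
  quotient_topology (Quotient.quot (int_subgroup R)).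

Section TorusInstances.
Variable R : realType.
HB.instance Definition _ := PointedTopological.on (torus R).
HB.instance Definition _ := GRing.isZmodule.Build (torus R)
  (@Quotient.addqA R (int_subgroup R)) (@Quotient.addqC R (int_subgroup R))
  (@Quotient.add0q R (int_subgroup R)) (@Quotient.addNq R (int_subgroup R)).
End TorusInstances.

Definition to_torus (R : realType) (x : R) : torus R := \pi_(torus R) x.

Lemma to_torusB (R : realType) (x y : R) :
  to_torus (x - y) = to_torus x - to_torus y.
Proof. exact: (@pi_is_zmod_morphism R _ _ (Quotient.quot (int_subgroup R))). Qed.

Lemma to_torus_eq (R : realType) (x y : R) :
  to_torus x = to_torus y <-> x - y \is a Num.int.
Proof.
have -> : (x - y \is a Num.int) = (x - y \in int_subgroup R) by [].
by rewrite Quotient.idealrBE; split=> [xy|/eqP xy]; [apply/eqP|]; exact: xy.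
Qed.

Definition semigroup_of_nat (S : set nat) : Prop :=
  [/\ S !=set0, forall s, S s -> (0 < s)%N &
      forall s t, S s -> S t -> S (s * t)%N].

Definition mult_independent (p q : nat) : Prop :=
  ~ exists a b : nat, [/\ (0 < a)%N, (0 < b)%N & (p ^ a = q ^ b)%N].

Definition non_lacunary (S : set nat) : Prop :=
  exists p q : nat,
    [/\ S p, S q, (2 <= p)%N, (2 <= q)%N & mult_independent p q].

Definition torus_act (R : realType) (d : nat)
    (k : 'rV[int]_d) (x : 'rV[torus R]_d) : 'rV[torus R]_d :=
  \row_i (x ord0 i *~ k ord0 i).

Definition invariant_under (R : realType) (d : nat)
    (S : set 'rV[int]_d) (A : set 'rV[torus R]_d) : Prop :=
  forall k x, S k -> A x -> A (torus_act k x).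

Definition power_vectors (d : nat) (l : 'I_d -> nat) (Sigma : set nat) :
    set 'rV[int]_d :=
  [set \row_i ((s ^ l i)%N%:Z) | s in Sigma].

Definition rational_point (R : realType) (d : nat) (x : 'rV[torus R]_d) : Prop :=
  forall i, exists q : rat, x ord0 i = to_torus (ratr q).

(* [denq q] is the denominator of q in lowest terms. Two rationals with the same
   class mod 1 have the same [denq], so the choice of q is immaterial. *)
Definition denominators_coprime (R : realType) (d : nat)
    (Sigma : set nat) (x : 'rV[torus R]_d) : Prop :=
  forall i, exists2 q : rat, x ord0 i = to_torus (ratr q) &
    forall s, Sigma s -> coprime `|denq q|%N s.

(* Main.v *)
Require Import Defs.
From mathcomp Require Import all_boot all_order all_algebra.
From mathcomp Require Import all_classical all_reals all_analysis.
From mathcomp Require Import cyclic.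
From mathcomp Require Import zify ring lra.

(** The torus is unfolded to R: a subset of the d-torus is a subset of R^d that
is stable under integer translations, and compactness is that of the unit cube.

_One coordinate._  Let p and q be multiplicatively independent and let B be a
closed nonempty 1-periodic set stable under multiplication by p and by q; then
B contains a rational ([rational_in_invariant], following Boshernitzan's proof
of Furstenberg's theorem).  The numbers p^i q^j are multiplicatively dense near
infinity: the ratios of consecutive ones tend to 1.  Hence every small enough
x > 0 has a multiple (p^i q^j) x just above any prescribed t > 0
([small_has_multiple]).  If B contains no rational, then the orbit of any of its
points is infinite modulo 1, so B - B contains arbitrarily small positive
numbers; their multiples stay in B - B, and compactness gives t in B - B, i.e. B
meets B - t ([translate_meets]).  When t = 1/m with p = q = 1 modulo m, the
intersection of B and B - t satisfies the same hypotheses as B, so that the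
argument can be repeated and yields x, x + t, ..., x + m t in B
([progression_in]).  Passing to powers of p and q, m can be any integer prime to
p q, hence arbitrarily large; so 0 is a limit of points of B, and B contains the
rational 0 after all.

For a whole non-lacunary set of multipliers, a rational of least denominator n
in B has n coprime to each multiplier s: otherwise multiplication by s would
lower the denominator ([coprime_rational_in]).

_All coordinates._  Induction on the coordinates ([coprime_row_in]).  The
projection of A to coordinate j is closed by compactness, and invariant under
the s^(l_j), so it contains a rational r whose denominator n is coprime to
Sigma.  Let Sigma' be the set of the s in Sigma that fix r modulo 1.  By Euler's
theorem it contains the power s^(phi(n)) of every s in Sigma.  Therefore Sigma'
is again non-lacunary, the fibre of A above r is invariant under Sigma', and
being coprime to Sigma' is the same as being coprime to Sigma: the induction
hypothesis applies to the fibre. *)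

Set Implicit Arguments.
Unset Strict Implicit.
Unset Printing Implicit Defensive.

Import Order.TTheory GRing.Theory Num.Theory.
Import numFieldNormedType.Exports.

Local Open Scope classical_set_scope.
Local Open Scope ring_scope.

(** * Multiplicative density of the products of powers of two integers *)

(** Pigeonhole on the bins of width [e]. *)
Lemma close_terms (R : realType) (u : nat -> R) (K e : R) :
    (forall n, 0 <= u n < K) -> 0 < e ->
  exists m n, (m < n)%N /\ `|u n - u m| < e.
Proof.
move=> uK e0; set B := (Num.truncn (K / e)).+1.
have bin_lt n : (Num.truncn (u n / e) < B)%N.
  have /andP[_ /ltW un] := uK n.
  by rewrite ltnS; apply: le_truncn; rewrite ler_pM2r ?invr_gt0.
pose bin (i : 'I_B.+1) : 'I_B := Ordinal (bin_lt i).
have /injectivePn[i [j ij binij]] : ~~ injectiveb bin.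
  apply/negP => /injectiveP /leq_card.
  by rewrite !card_ord ltnn.
have close : `|u i - u j| < e.
  have /(congr1 val)/= tij := binij.
  have [/andP[ui0 _] /andP[uj0 _]] := (uK i, uK j).
  have /andP[ai bi] := truncn_itv (divr_ge0 ui0 (ltW e0)).
  have /andP[aj bj] := truncn_itv (divr_ge0 uj0 (ltW e0)).
  rewrite tij -natr1 in ai bi; rewrite -natr1 in bj.
  rewrite -[e in _ < e]mul1r -ltr_pdivrMr // -[X in _ / X]gtr0_norm // -normf_div.
  by rewrite mulrBl real_ltr_norml ?num_real //; lra.
move: ij; rewrite -val_eqE /= neq_ltn => /orP[ij|ji].
  by exists i, j; rewrite ij distrC close.
by exists j, i; rewrite ji close.
Qed.

(** Bernoulli's inequality. *)
Lemma expr_unbounded (R : realType) (r C : R) : 1 < r -> exists n, C < r ^+ n.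
Proof.
move=> r1; have bern n : n%:R * (r - 1) <= r ^+ n.
  elim: n => [|n IHn]; first by rewrite mul0r expr0.
  have := exprn_ege1 n (ltW r1); rewrite exprS -natr1.
  by move: (n%:R) (r ^+ n) IHn => a b; nra.
exists (Num.truncn (C / (r - 1))).+1; apply: lt_le_trans (bern _).
by rewrite -ltr_pdivrMr ?subr_gt0 // truncnS_gt.
Qed.

Lemma mult_independentX p q u v : (0 < u)%N -> (0 < v)%N ->
  mult_independent p q -> mult_independent (p ^ u) (q ^ v).
Proof.
move=> u0 v0 pq [a [b [a0 b0 E]]]; apply: pq; exists (u * a)%N, (v * b)%N.
by rewrite !muln_gt0 u0 v0 !expnM; split.
Qed.

(** Divide [p ^ i] by the largest power of [q] not above it: the quotients lie
between 1 and [q], so two of them are close, and their ratio is a quotient of a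
power of [p] by a power of [q].  Multiplicative independence keeps it from being
1.
Which of the two powers is the larger is not controlled, hence the
disjunction. *)
Lemma ratio_near_one (R : realType) (p q : nat) (e : R) :
    (1 < p)%N -> (1 < q)%N -> mult_independent p q -> 0 < e ->
  exists a b, 1 < (p%:R : R) ^+ a / q%:R ^+ b < 1 + e \/
              1 < (q%:R : R) ^+ b / p%:R ^+ a < 1 + e.
Proof.
move=> p1 q1 pq e0; pose j i := trunc_log q (p ^ i).
have p0 : 0 < p%:R :> R by rewrite ltr0n ltnW.
have q0 : 0 < q%:R :> R by rewrite ltr0n ltnW.
pose x i : R := p%:R ^+ i / q%:R ^+ j i.
have xP i : 1 <= x i < q%:R.
  have pi0 : (0 < p ^ i)%N by rewrite expn_gt0 ltnW.
  have /andP[lo hi] := trunc_log_bounds q1 pi0.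
  rewrite ler_pdivlMr ?exprn_gt0 // mul1r ltr_pdivrMr ?exprn_gt0 //.
  by rewrite -exprS -!natrX ler_nat ltr_nat lo hi.
have [i [i' [ii' close]]] : exists m n, (m < n)%N /\ `|x n - x m| < Num.min e 1.
  apply: (@close_terms _ _ q%:R); last by rewrite lt_min e0 ltr01.
  by move=> n; have /andP[x1 ->] := xP n; rewrite (le_trans _ x1).
have jj' : (j i <= j i')%N.
  by apply: leq_trunc_log; rewrite leq_exp2l // ltnW.
exists (i' - i)%N, (j i' - j i)%N.
have x'E : x i' = x i * (p%:R ^+ (i' - i) / q%:R ^+ (j i' - j i)).
  rewrite /x -{1}(subnKC (ltnW ii')) -{1}(subnKC jj') !exprD; field.
  by rewrite ?mulf_neq0 ?expf_neq0 ?gt_eqF.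
have /andP[x1 _] := xP i; have /andP[x'1 _] := xP i'.
set r := _ / _ in x'E *.
have rV : q%:R ^+ (j i' - j i) / p%:R ^+ (i' - i) = r^-1 by rewrite invf_div.
rewrite rV; move: close; rewrite lt_min => /andP[ce c1].
have r0 : 0 < r by rewrite divr_gt0 ?exprn_gt0.
(* As x i and x i' are at least 1, their ratio is at least as close to 1 as
   they are to each other. *)
have [r_lt1|r_gt1|r1] := ltgtP r 1.
- right; rewrite invf_gt1 // r_lt1 /=.
  rewrite invf_plt ?posrE //; last by rewrite addr_gt0.
  rewrite -(ltr_pM2l (lt_le_trans ltr01 x1)) -x'E ltr_pdivrMr; last lra.
  move: ce; rewrite real_ltr_norml ?num_real // => /andP[ce _].
  have : 0 <= e * (x i' - 1) by rewrite mulr_ge0 ?subr_ge0 // ltW.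
  by move: ce; lra.
- left => /=; move: ce.
  rewrite x'E real_ltr_norml ?num_real // => /andP[_ ce].
  have : 0 <= (x i - 1) * (r - 1) by rewrite mulr_ge0 ?subr_ge0 // ltW.
  by move: ce; lra.
case: pq; exists (i' - i)%N, (j i' - j i)%N; split.
- by rewrite subn_gt0.
(* If both quotients had the same power of q, their ratio, which is 1 here,
   would be a positive power of p. *)
- rewrite lt0n; apply/eqP => j0; move: c1.
  have : p%:R <= r.
    rewrite /r j0 expr0 divr1 -{1}[p%:R]expr1 ler_weXn2l ?subn_gt0 //.
    by rewrite ler1n ltnW.
  by rewrite r1 lern1 leqNgt p1.
apply/eqP; rewrite -(eqr_nat R) !natrX; apply/eqP.
rewrite -[LHS](@divfK _ (q%:R ^+ (j i' - j i))) ?expf_neq0 ?gt_eqF //.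
by rewrite -/r r1 mul1r.
Qed.

(** With [r := p ^ a / q ^ b] between 1 and [1 + e], the numbers [q ^ m * r ^ k] for
[k <= K], where [r ^ K > q], fill the gap from [q ^ m] to [q ^ m.+1] in steps of
ratio less than [1 + e].  They are integers of the form [p ^ i * q ^ j] as soon
as [b * K <= m]. *)
Lemma fill_ratio (R : realType) (p q a b : nat) (e : R) : (1 < q)%N ->
    1 < (p%:R : R) ^+ a / q%:R ^+ b < 1 + e ->
  exists2 N : R, 0 < N & forall y, N <= y ->
    exists i j, y < (p ^ i * q ^ j)%:R <= (1 + e) * y.
Proof.
move=> q1; set r := (_ / _ : R) => /andP[r1 re].
have q0 : 0 < q%:R :> R by rewrite ltr0n ltnW.
have q1R : 1 < q%:R :> R by rewrite ltr1n.
have [K rK] := expr_unbounded q%:R r1.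
exists (q%:R ^+ (b * K)) => [|y yN]; first by rewrite exprn_gt0.
have y0 : 0 < y by apply: lt_le_trans yN; rewrite exprn_gt0.
have [n0 yn0] := expr_unbounded y q1R.
have ex_m : exists m, y < q%:R ^+ m.+1.
  exists n0; apply: lt_trans yn0 _.
  by rewrite exprS ltr_pMl ?exprn_gt0.
case: (ex_minnP ex_m) => m ym min_m.
have bKm : (b * K <= m)%N.
  by rewrite -ltnS -(ltr_eXn2l q1R); apply: le_lt_trans ym.
have my : q%:R ^+ m <= y.
  case: m ym min_m bKm => [|m] ym min_m bKm.
    by rewrite expr0; apply: le_trans yN; rewrite exprn_ege1 // ltW.
  by rewrite leNgt; apply/negP => /min_m; rewrite ltnn.
have ex_k : exists k, y < q%:R ^+ m * r ^+ k.
  exists K; apply: lt_trans ym _.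
  by rewrite exprSr ltr_pM2l ?exprn_gt0.
case: (ex_minnP ex_k) => -[|k] yk min_k.
  by move: yk; rewrite expr0 mulr1 ltNge my.
have kK : (k.+1 <= K)%N.
  apply: min_k; apply: lt_trans ym _.
  by rewrite exprSr ltr_pM2l ?exprn_gt0.
have ky : q%:R ^+ m * r ^+ k <= y.
  by rewrite leNgt; apply/negP => /min_k; rewrite ltnn.
have bkm : (b * k.+1 <= m)%N by apply: leq_trans bKm; rewrite leq_mul2l kK orbT.
exists (a * k.+1)%N, (m - b * k.+1)%N.
have -> : (p ^ (a * k.+1) * q ^ (m - b * k.+1))%:R = q%:R ^+ m * r ^+ k.+1.
  rewrite /r expr_div_n natrM !natrX -{2}(subnKC bkm) exprD -!exprM.
  by field; rewrite expf_neq0 ?gt_eqF.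
rewrite yk /= exprSr mulrA; apply: le_trans (_ : y * r <= _).
  by rewrite ler_pM2r //; apply: lt_trans r1.
by rewrite mulrC ler_pM2r // ltW.
Qed.

Lemma small_has_multiple (R : realType) (p q : nat) (t e : R) :
    (1 < p)%N -> (1 < q)%N -> mult_independent p q -> 0 < t -> 0 < e ->
  exists2 delta, 0 < delta & forall x, 0 < x < delta ->
    exists i j, t < (p ^ i * q ^ j)%:R * x <= t + e.
Proof.
move=> p1 q1 pq t0 e0.
have [N N0 NP] : exists2 N : R, 0 < N & forall y, N <= y ->
    exists i j, y < (p ^ i * q ^ j)%:R <= (1 + e / t) * y.
  have [a [b [ab|ba]]] := ratio_near_one p1 q1 pq (divr_gt0 e0 t0).
    exact: fill_ratio ab.
  have [N N0 NP] := fill_ratio p1 ba.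
  exists N => // y /NP[i [j ij]]; exists j, i; by rewrite mulnC.
exists (t / N) => [|x /andP[x0 xt]]; first exact: divr_gt0.
have [|i [j /andP[lo hi]]] := NP (t / x).
  by rewrite ler_pdivlMr // mulrC -ler_pdivlMr // ltW.
exists i, j; rewrite -ltr_pdivrMr // lo /= -ler_pdivlMr //.
by apply: le_trans hi _; rewrite le_eqVlt; apply/orP; left; apply/eqP; field; lra.
Qed.

(** * Closed invariant sets of the circle *)
Definition periodic (R : realType) (B : set R) :=
  forall x (n : int), B x -> B (x + n%:~R).

Definition times_stable (R : realType) (n : nat) (B : set R) :=
  forall x, B x -> B (n%:R * x).

Definition closed_invariant (R : realType) (p q : nat) (B : set R) :=
  [/\ closed B, periodic B, times_stable p B, times_stable q B & B !=set0].

Lemma periodic_frac (R : realType) (B : set R) x :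
  periodic B -> B x -> B (x - (Num.floor x)%:~R).
Proof. by move=> perB Bx; rewrite -mulrNz; apply: perB. Qed.

Lemma frac_itv (R : realType) (x : R) : 0 <= x - (Num.floor x)%:~R < 1.
Proof. by have := floor_itv x; rewrite intrD; lra. Qed.

Lemma times_stableX (R : realType) n u (B : set R) :
  times_stable n B -> times_stable (n ^ u) B.
Proof.
move=> nB x Bx; elim: u => [|u IHu]; first by rewrite expn0 mul1r.
by rewrite expnS natrM -mulrA; apply: nB.
Qed.

Lemma times_stableM (R : realType) m n (B : set R) :
  times_stable m B -> times_stable n B -> times_stable (m * n) B.
Proof. by move=> mB nB x Bx; rewrite natrM -mulrA; apply/mB/nB. Qed.

(** The points [p ^ n * x] are distinct modulo 1, because an integer relation
[(p ^ n - p ^ m) * x = c] would make [x] rational. *)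
Lemma close_points (R : realType) (p : nat) (B : set R) (e : R) :
    (1 < p)%N -> periodic B -> times_stable p B -> B !=set0 ->
    (forall r : rat, ~ B (ratr r)) -> 0 < e ->
  exists x y, [/\ B x, B y & 0 < y - x < e].
Proof.
move=> p1 perB pB [x Bx] Birr e0.
pose v n : R := (p ^ n)%:R * x; pose u n := v n - (Num.floor (v n))%:~R.
have Bu n : B (u n) by apply: periodic_frac => //; exact: times_stableX.
have [m [n [mn close]]] := close_terms (fun n => frac_itv (v n)) e0.
rewrite -/(u m) -/(u n) in close.
have [unm|umn|eq_u] := ltgtP (u m) (u n).
- exists (u m), (u n); split=> //; rewrite subr_gt0 unm /=.
  by apply: le_lt_trans close; exact: ler_norm.
- exists (u n), (u m); split=> //; rewrite subr_gt0 umn /=.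
  by apply: le_lt_trans close; rewrite distrC; exact: ler_norm.
have lt_pmn : (p ^ m < p ^ n)%N by rewrite ltn_exp2l.
case: (Birr ((Num.floor (v n) - Num.floor (v m))%:~R
  / ((p ^ n)%:R - (p ^ m)%:R))).
suff -> : ratr ((Num.floor (v n) - Num.floor (v m))%:~R
    / ((p ^ n)%:R - (p ^ m)%:R)) = x by [].
rewrite fmorph_div /= [ratr (_ - _)]rmorphB /= !ratr_nat ratr_int intrB.
have pmn0 : (p ^ n)%:R - (p ^ m)%:R != 0 :> R.
  by rewrite subr_eq0 eqr_nat gtn_eqF.
apply: (mulIf pmn0); rewrite divfK //.
move: eq_u; rewrite /u /v.
by lra.
Qed.

(** [B - B] is stable under multiplication by [p] and [q] and contains small
positive numbers, hence comes arbitrarily close to [t].  By compactness of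
[[0, 1]], if [B] were disjoint from [B - t], it would be disjoint from [B - d]
for all [d] near [t]. *)
Lemma translate_meets (R : realType) (p q : nat) (B : set R) (t : R) :
    (1 < p)%N -> (1 < q)%N -> mult_independent p q -> closed_invariant p q B ->
    (forall r : rat, ~ B (ratr r)) -> 0 < t ->
  exists x, B x /\ B (x + t).
Proof.
move=> p1 q1 pq [clB perB pB qB B0] Birr t0; apply: contrapT => noB.
have /compact_near_coveringP cover := @segment_compact R 0 1.
have /nbhs_ballP[e /= e0 te] :
    \forall d \near nbhs t, `[0, 1] `<=` (fun x : R => ~ (B x /\ B (x + d))).
  apply: cover => x _.
  (* Disjointness at (x, t) is an open condition on the pair. *)
  have opC : open (~` [set z : R * R | B z.1 /\ B (z.1 + z.2)]).
    apply: closed_openC; apply: closedI.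
      by apply: preimage_closed clB => z _; exact: cvg_fst.
    by apply: preimage_closed clB => z _; exact: add_continuous.
  have /= := @open_nbhs_nbhs _ (x, t) _ (conj opC _).
  by apply=> Bxt; apply: noB; exists x.
have [delta delta0 dP] := small_has_multiple p1 q1 pq t0 (divr_gt0 e0 (ltr0Sn _ 1)).
have [x [y [Bx By /dP[i [j /andP[lo hi]]]]]] :=
  close_points p1 perB pB B0 Birr delta0.
pose s := (p ^ i * q ^ j)%N; rewrite -/s mulrBr in lo hi.
have sB : times_stable s B by apply: times_stableM; apply: times_stableX.
pose x0 := s%:R * x - (Num.floor (s%:R * x))%:~R.
have /andP[x00 /ltW x01] := frac_itv (s%:R * x).
apply: (te (s%:R * y - s%:R * x) _ x0).
- by rewrite /ball /= real_ltr_norml ?num_real //; move: lo hi; lra.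
- by rewrite /= in_itv /= x00 x01.
split; first by apply: periodic_frac => //; exact: sB.
have -> : x0 + (s%:R * y - s%:R * x) = s%:R * y + (- Num.floor (s%:R * x))%:~R.
  by rewrite /x0 mulrNz; ring.
by apply: perB; exact: sB.
Qed.

(** Induction on the length: [C], the intersection of [B] and [B - t], inherits
the hypotheses on [B], the integrality of [(p - 1) * t] and [(q - 1) * t] being
what makes it stable under [p] and [q].  A progression in [C], followed by one
more step, is a progression in [B]. *)
Lemma progression_in (R : realType) (p q : nat) (t : R) :
    (1 < p)%N -> (1 < q)%N -> mult_independent p q -> 0 < t ->
    (p%:R - 1) * t \is a Num.int -> (q%:R - 1) * t \is a Num.int ->
  forall k (B : set R), closed_invariant p q B ->
    (forall r : rat, ~ B (ratr r)) ->
  exists x, forall i, (i <= k)%N -> B (x + i%:R * t).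
Proof.
move=> p1 q1 pq t0 pt qt; elim=> [|k IHk] B invB Birr.
  have [_ _ _ _ [x Bx]] := invB.
  by exists x => i; rewrite leqn0 => /eqP->; rewrite mul0r addr0.
have [clB perB pB qB _] := invB.
pose C := [set x | B x /\ B (x + t)].
have stableC n : times_stable n B -> (n%:R - 1) * t \is a Num.int ->
    times_stable n C.
  move=> nB /intrP[c nt] x [Bx Bxt]; split; first exact: nB.
  have -> : n%:R * x + t = n%:R * (x + t) + (- c)%:~R by rewrite mulrNz -nt; ring.
  by apply: perB; exact: nB.
have [||x Cx] := IHk C.
- split; try exact: stableC.
  + apply: closedI => //; apply: preimage_closed clB => x _.
    by apply: cvgD; [exact: cvg_id|exact: cvg_cst].
  + by move=> x n [Bx Bxt]; split; [exact: perB|rewrite addrAC; exact: perB].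
  + exact: translate_meets invB Birr t0.
- by move=> r [/Birr].
exists x => -[|i] ik; first by have [] := Cx 0%N isT.
by have [_] := Cx i ik; rewrite -addrA -natr1 mulrDl mul1r.
Qed.

(** Euler's theorem, read in [R]. *)
Lemma totient_power_int (R : realType) (m n : nat) : coprime n m ->
  ((n ^ totient m)%:R - 1) / m%:R \is a @Num.int R.
Proof.
case: m => [|m] cop; first by rewrite invr0 mulr0.
have /eqP := Euler_exp_totient cop.
case: (posnP n) => [n0|n0].
  move: cop; rewrite n0 /coprime gcd0n => /eqP->.
  by rewrite divr1 rpredB ?natr_int ?rpred1.
rewrite eqn_mod_dvd ?expn_gt0 ?n0 // => /dvdnP[c cE].
rewrite -[X in _ - X]/(1%:R) -natrB ?expn_gt0 ?n0 // cE natrM mulfK ?pnatr_eq0 //.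
Qed.

(** A progression of step [1/m] and length [m] passes within [1/m] of an
integer, and [m] is arbitrarily large. *)
Lemma rational_in_invariant (R : realType) (p q : nat) (B : set R) :
    (1 < p)%N -> (1 < q)%N -> mult_independent p q -> closed_invariant p q B ->
  exists r : rat, B (ratr r).
Proof.
move=> p1 q1 pq invB; have [clB perB pB qB B0] := invB.
apply: contrapT => noB.
have Birr r : ~ B (ratr r) by move=> Br; apply: noB; exists r.
apply: (Birr 0); rewrite raddf0; apply: (clB) => U /nbhs_ballP[e /= e0 eU].
(* m is prime to p and q, and larger than 1/e. *)
pose m := (p * q * (Num.truncn e^-1).+1).+1.
have m0 : 0 < m%:R :> R by rewrite ltr0n.
have me : m%:R^-1 < e.
  rewrite invf_plt ?posrE //; apply: lt_trans (truncnS_gt _) _.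
  by rewrite ltr_nat ltnS leq_pmull // muln_gt0 (ltnW p1) (ltnW q1).
pose u := totient m; have u0 : (0 < u)%N by rewrite totient_gt0.
have integral n : (n %| p * q)%N ->
    ((n ^ u)%:R - 1) * m%:R^-1 \is a @Num.int R.
  move=> n_pq; apply: totient_power_int; apply: (coprime_dvdl _ (coprimenS _)).
  exact: dvdn_mulr.
have [||||||||x Bx] := @progression_in R (p ^ u) (q ^ u) m%:R^-1 _ _ _ _ _ _ m B.
- by rewrite -(exp1n u) ltn_exp2r.
- by rewrite -(exp1n u) ltn_exp2r.
- exact: mult_independentX.
- by rewrite invr_gt0.
- by apply: integral; exact: dvdn_mulr.
- by apply: integral; exact: dvdn_mull.
- by split=> //; apply: times_stableX.
- exact: Birr.
have /andP[x0 x1] := frac_itv x; set y := x - _ in x0 x1.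
have : 0 <= m%:R * (1 - y) by rewrite mulr_ge0 // subr_ge0 ltW.
move=> /truncn_itv; set i := Num.truncn _ => /andP[ilo ihi].
(* With y the fractional part of x, i is the last index for which y + i/m does
   not exceed 1. *)
exists (x + i%:R * m%:R^-1 + (- Num.floor x - 1)%:~R); split.
  apply: perB; apply: Bx.
  rewrite -(ler_nat R); apply: le_trans ilo _.
  by rewrite ler_piMr // lerBlDr lerDl.
apply: eU; rewrite /ball /= sub0r normrN.
have -> : x + i%:R * m%:R^-1 + (- Num.floor x - 1)%:~R = i%:R / m%:R - (1 - y).
  by rewrite intrB mulrNz /y; ring.
apply: le_lt_trans me; rewrite ler_norml.
move: ilo ihi; rewrite -natr1 ![m%:R * _]mulrC -ler_pdivrMr // -ltr_pdivlMr //.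
by rewrite mulrDl; lra.
Qed.

Lemma denq_div_le (a b : int) : b != 0 -> (`|denq (a%:Q / b%:Q)| <= `|b|)%N.
Proof.
by case: divqP => //= k x k0 _; rewrite abszM leq_pmull // absz_gt0.
Qed.

Lemma denq_mul_lt (s : nat) (q : rat) : ~~ coprime `|denq q| s ->
  (`|denq (s%:R * q)| < `|denq q|)%N.
Proof.
set n := `|denq q|%N; set g := gcdn n s => ncop.
have n0 : (0 < n)%N by rewrite absz_gt0 denq_neq0.
have g0 : (0 < g)%N by rewrite gcdn_gt0 n0.
have g1 : (1 < g)%N by move: ncop; rewrite /coprime -/g neq_ltn ltnNge g0.
have [[a sE] [b nE]] := (dvdnP (dvdn_gcdr n s), dvdnP (dvdn_gcdl n s)).
rewrite -/g in sE nE.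
have b0 : (0 < b)%N by move: n0; rewrite nE muln_gt0 => /andP[].
have -> : s%:R * q = (numq q * a%:Z)%:~R / (b%:Z)%:~R.
  rewrite -{1}[q]divq_num_den -absz_denq -/n nE sE !PoszM !intrM -!pmulrn natrM.
  by field; rewrite !pnatr_eq0 -!lt0n b0.
apply: leq_ltn_trans (denq_div_le _ _) _; first by rewrite eqz_nat -lt0n.
by rewrite nE ltn_Pmulr.
Qed.

(** Descent on the denominator: if it is not coprime to some [s], multiplication
by [s] lowers it ([denq_mul_lt]). *)
Lemma coprime_rational_in (R : realType) (S : set nat) (B : set R) :
    non_lacunary S -> closed B -> periodic B -> B !=set0 ->
    (forall s, S s -> times_stable s B) ->
  exists q : rat, B (ratr q) /\ forall s, S s -> coprime `|denq q| s.
Proof.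
move=> [p [q [Sp Sq p1 q1 pq]]] clB perB B0 SB.
have [r Br] : exists r : rat, B (ratr r).
  by apply: (rational_in_invariant p1 q1 pq); split=> //; exact: SB.
have [n] := ubnP `|denq r|%N; elim: n r Br => // n IHn r Br; rewrite ltnS => rn.
have [cop|] := pselect (forall s, S s -> coprime `|denq r| s); first by exists r.
move=> /existsNP[s /not_implyP[Ss /negP ncop]].
apply: (IHn (s%:R * r)); last exact: leq_trans (denq_mul_lt ncop) rn.
by rewrite rmorphM /= ratr_nat; apply: SB.
Qed.

(** * Invariant sets in several coordinates *)
Lemma row_continuous (T U : topologicalType) (d : nat) (f : T -> 'rV[U]_d) :
  (forall i, continuous (fun x => f x ord0 i)) -> continuous f.
Proof.
move=> fc x A [P Pfx PA]; rewrite nbhs_simpl.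
have : \forall y \near x, forall i, P ord0 i (f y ord0 i).
  by apply: filter_forall => i; apply: fc; exact: Pfx.
by apply: filterS => y Py; apply: PA => i j; rewrite ord1.
Qed.

Definition periodic_row (R : realType) (d : nat) (A : set 'rV[R]_d) :=
  forall x (n : 'rV[int]_d), A x -> A (x + map_mx intr n).

(** Periodicity lets the other coordinates range over a cube, and the projection
of a closed set along a compact factor is closed.  [upd r' z] overwrites
coordinate [j] of [z], which keeps the ambient space unchanged. *)
Lemma closed_coordinate (R : realType) (d : nat) (A : set 'rV[R]_d) (j : 'I_d) :
  closed A -> periodic_row A -> closed [set x ord0 j | x in A].
Proof.
move=> clA perA; rewrite -openC openE => r nAr.
pose upd (r' : R) (z : 'rV[R]_d) := \row_i (if i == j then r' else z ord0 i).
have upd_cont : continuous (fun y : 'rV[R]_d * R => upd y.2 y.1).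
  apply: row_continuous => i y.
  have [ij|ij] := boolP (i == j).
    rewrite (_ : (fun _ => _) = snd); first exact: cvg_snd.
    by apply/funext => y'; rewrite mxE ij.
  rewrite (_ : (fun _ => _) = (fun z : 'rV[R]_d => z ord0 i) \o fst).
    by apply: continuous_comp; [exact: cvg_fst|exact: coord_continuous].
  by apply/funext => y'; rewrite mxE (negbTE ij).
have /compact_near_coveringP cover :=
  @rV_compact R d (fun=> `[0, 1]%classic) (fun=> @segment_compact R 0 1).
have : \forall r' \near nbhs r,
    [set z : 'rV[R]_d | forall i, `[0, 1]%classic (z ord0 i)] `<=`
    (fun z => ~ A (upd r' z)).
  apply: cover => z _.
  have opC : open (~` [set y : 'rV[R]_d * R | A (upd y.2 y.1)]).
    apply: closed_openC; apply: preimage_closed clA => y _; exact: upd_cont.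
  have /= := @open_nbhs_nbhs _ (z, r) _ (conj opC _).
  apply=> Azr; apply: nAr; exists (upd r z) => //.
  by rewrite mxE eqxx.
apply: filterS => r' noA [x Ax xr'].
pose z := \row_i (x ord0 i - (Num.floor (x ord0 i))%:~R) : 'rV[R]_d.
apply: (noA z) => [i|].
  rewrite mxE /= in_itv /=.
  by have /andP[-> /ltW] := frac_itv (x ord0 i).
suff -> : upd r' z = x + map_mx intr
    (\row_i (if i == j then 0 else - Num.floor (x ord0 i))) by exact: perA.
apply/rowP => i; rewrite !mxE; have [->|_] := eqVneq i j.
  by rewrite xr' mulr0z addr0.
by rewrite mulrNz.
Qed.

Lemma closed_Rint (R : realType) : closed [set x : R | x \is a Num.int].
Proof.
rewrite -openC openE => x /= /negP xNint; have /andP[lo hi] := floor_itv x.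
have : x \in `](Num.floor x)%:~R, (Num.floor x + 1)%:~R[.
  by rewrite in_itv /= hi andbT lt_neqAle lo andbT -intrEfloor.
move=> /near_in_itvoo; apply: filterS => y; rewrite in_itv /= => /andP[ly yh].
by move=> /intrP[n yn]; move: ly yh; rewrite yn !ltr_int; lia.
Qed.

Definition coprime_class (R : realType) (S : set nat) (x : R) :=
  exists q : rat, x - ratr q \is a Num.int /\
    forall s, S s -> coprime `|denq q| s.

Definition mul_closed (S : set nat) := forall s t, S s -> S t -> S (s * t)%N.

Lemma mul_closedX (S : set nat) s u :
  mul_closed S -> S s -> (0 < u)%N -> S (s ^ u)%N.
Proof.
move=> SM Ss; case: u => // u _.
by elim: u => [|u IHu]; rewrite ?expn1 // expnS; apply: SM.
Qed.

(** The multipliers [s] for which [s ^ l] fixes [x] modulo 1. *)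
Definition fixing (R : realType) (S : set nat) (l : nat) (x : R) : set nat :=
  [set s | S s /\ ((s ^ l)%:R - 1) * x \is a Num.int].

Lemma fixing_mul_closed (R : realType) (S : set nat) (l : nat) (x : R) :
  mul_closed S -> mul_closed (fixing S l x).
Proof.
move=> SM s t [Ss sx] [St tx]; split; first exact: SM.
have -> : ((s * t) ^ l)%:R - 1 =
    (s ^ l)%:R * ((t ^ l)%:R - 1) + ((s ^ l)%:R - 1) :> R.
  by rewrite expnMn natrM; ring.
by rewrite mulrDl -mulrA rpredD // rpredM // natr_int.
Qed.

(** Euler's theorem for the denominator of [q]. *)
Lemma fixing_power (R : realType) (S : set nat) (l : nat) (q : rat) s :
    mul_closed S -> S s -> coprime `|denq q| (s ^ l) ->
  fixing S l (ratr q : R) (s ^ totient `|denq q|)%N.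
Proof.
move=> SM Ss cop; split.
  by apply: mul_closedX => //; rewrite totient_gt0 absz_gt0 denq_neq0.
rewrite coprime_sym in cop; rewrite -expnM mulnC expnM.
have := totient_power_int R cop; move: (_ - 1) => c cint.
rewrite -[q in ratr q]divq_num_den fmorph_div /= !ratr_int -absz_denq -pmulrn.
rewrite mulrA mulrAC.
by rewrite rpredM ?intr_int.
Qed.

(** Coordinates are treated one at a time, along an arbitrary list; [S] and [A]
vary in the induction, since fixing a coordinate shrinks both. *)
Lemma coprime_row_in (R : realType) (d : nat) (l : 'I_d -> nat)
    (hl : forall i, (0 < l i)%N) (js : seq 'I_d) :
  forall (S : set nat) (A : set 'rV[R]_d),
    mul_closed S -> non_lacunary S ->
    closed A -> periodic_row A -> A !=set0 ->
    (forall s x, S s -> A x -> A (\row_i ((s ^ l i)%:R * x ord0 i))) ->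
  exists x, A x /\ forall j, j \in js -> coprime_class S (x ord0 j).
Proof.
elim: js => [|j js IHjs] S A SM nlS clA perA A0 SA.
  by have [x Ax] := A0; exists x.
pose B := [set x ord0 j | x in A].
have [p [q [Sp Sq p1 q1 pq]]] := nlS.
have [r [[z Az zr] cop]] : exists r : rat, B (ratr r) /\
    forall s, [set (s ^ l j)%N | s in S] s -> coprime `|denq r| s.
  apply: coprime_rational_in.
  - exists (p ^ l j)%N, (q ^ l j)%N; split; [by exists p|by exists q| | |].
    + by rewrite -(exp1n (l j)) ltn_exp2r.
    + by rewrite -(exp1n (l j)) ltn_exp2r.
    + exact: mult_independentX.
  - exact: closed_coordinate.
  - move=> _ n [x Ax <-]; exists (x + map_mx intr (const_mx n)).
      exact: perA.
    by rewrite !mxE.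
  - by have [x Ax] := A0; exists (x ord0 j); exists x.
  - move=> _ [s Ss <-] _ [x Ax <-].
    exists (\row_i ((s ^ l i)%:R * x ord0 i)); first exact: SA.
    by rewrite mxE.
have copX s : S s -> coprime `|denq r| (s ^ l j) by move=> Ss; apply: cop; exists s.
set u := totient `|denq r|.
have u0 : (0 < u)%N by rewrite totient_gt0 absz_gt0 denq_neq0.
have fixX s : S s -> fixing S (l j) (ratr r : R) (s ^ u)%N.
  by move=> Ss; apply: fixing_power => //; exact: copX.
(* The fibre of A over the class of r, kept periodic. *)
pose A' := [set x | A x /\ x ord0 j - ratr r \is a Num.int].
have [||||||x [[Ax xr] xjs]] := IHjs (fixing S (l j) (ratr r : R)) A'.
- exact: fixing_mul_closed.
- exists (p ^ u)%N, (q ^ u)%N; split; try exact: fixX.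
  + by rewrite -(exp1n u) ltn_exp2r.
  + by rewrite -(exp1n u) ltn_exp2r.
  + exact: mult_independentX.
- apply: closedI => //; apply: (preimage_closed _ (@closed_Rint R)) => y _.
  apply: (@continuousB _ R^o 'rV[R]_d (fun x => x ord0 j) (cst (ratr r))).
    exact: coord_continuous.
  exact: cst_continuous.
- move=> x n [Ax xr]; split; first exact: perA.
  by rewrite !mxE addrAC rpredD // intr_int.
- by exists z; split=> //; rewrite zr subrr.
- move=> s x [Ss sr] [Ax xr]; split; first exact: SA.
  rewrite mxE (_ : _ - _ = (s ^ l j)%:R * (x ord0 j - ratr r)
    + ((s ^ l j)%:R - 1) * ratr r); last by ring.
  by rewrite rpredD // rpredM // natr_int.
exists x; split=> // i; rewrite in_cons => /orP[/eqP->|/xjs[q' [xq' copq']]].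
  by exists r; split=> // s /copX; rewrite coprime_pexpr.
(* A denominator coprime to a power of s is coprime to s. *)
exists q'; split=> // s Ss.
by rewrite -(coprime_pexpr _ _ u0); apply: copq'; exact: fixX.
Qed.

(** * Passage to the torus *)
Lemma to_torus_mulrn (R : realType) (x : R) (n : nat) :
  to_torus (n%:R * x) = to_torus x *+ n.
Proof.
have to_torus0 : to_torus (0 : R) = 0.
  by rewrite -(subrr (0 : R)) to_torusB subrr.
have to_torusD (a b : R) : to_torus (a + b) = to_torus a + to_torus b.
  rewrite -{1}[b]opprK to_torusB -[- b]sub0r to_torusB to_torus0.
  by rewrite sub0r opprK.
elim: n => [|n IHn]; first by rewrite mul0r mulr0n.
by rewrite -natr1 mulrDl mul1r to_torusD IHn mulrSr.
Qed.

Lemma to_torus_surj (R : realType) (y : torus R) : exists x, to_torus x = y.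
Proof. by exists (repr y); rewrite /to_torus reprK. Qed.

Lemma to_torus_row_continuous (R : realType) (d : nat) :
  continuous (fun x : 'rV[R]_d => \row_i to_torus (x ord0 i) : 'rV[torus R]_d).
Proof.
apply: row_continuous => i.
rewrite (_ : (fun _ => _) = @to_torus R \o (fun x : 'rV[R]_d => x ord0 i)).
  move=> x; apply: continuous_comp; first exact: coord_continuous.
  exact: pi_continuous.
by apply/funext => x; rewrite mxE.
Qed.

Unset Implicit Arguments.

Theorem proposition4 (R : realType) (Sigma : set nat)
    (hSigma : semigroup_of_nat Sigma) (hnl : non_lacunary Sigma)
    (d : nat) (hd : (0 < d)%N) (l : 'I_d -> nat) (hl : forall i, (0 < l i)%N)
    (A : set 'rV[torus R]_d) (hA0 : A !=set0) (hAc : closed A)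
    (hAinv : invariant_under (power_vectors l Sigma) A) :
  exists x : 'rV[torus R]_d,
    [/\ A x, rational_point x & denominators_coprime Sigma x].
Proof.
pose lift (x : 'rV[R]_d) : 'rV[torus R]_d := \row_i to_torus (x ord0 i).
have [|||||x [Ax xP]] :=
  @coprime_row_in R d l hl (enum 'I_d) Sigma (lift @^-1` A) _ hnl.
- by case: hSigma.
- by apply: preimage_closed hAc => x _; exact: to_torus_row_continuous.
- move=> x n; rewrite /preimage /= (_ : lift (x + _) = lift x) //.
  apply/rowP => i; rewrite !mxE; apply/to_torus_eq.
  by rewrite addrAC subrr add0r intr_int.
- have [y Ay] := hA0; pose f i := xget 0 [set a : R | to_torus a = y ord0 i].
  exists (\row_i f i); rewrite /preimage /= (_ : lift _ = y) //.
  apply/rowP => i; rewrite !mxE /f.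
  by have /(xgetPex 0) := to_torus_surj (y ord0 i).
- move=> s x Ss Ax; have := hAinv _ _ (ex_intro2 _ _ s Ss erefl) Ax.
  rewrite /preimage /=; congr A; apply/rowP => i.
  by rewrite !mxE to_torus_mulrn.
have xi i : exists2 q : rat, lift x ord0 i = to_torus (ratr q) &
    forall s, Sigma s -> coprime `|denq q|%N s.
  have [|q [xq cop]] := xP i; first by rewrite mem_enum.
  by exists q => //; rewrite mxE; apply/to_torus_eq.
exists (lift x); split=> // i; have [q] := xi i; by exists q.
Qed.
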